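(* Let $P=P(c)$ be a toric poset on a finite set $V$, and let $G=(V,E)$ be a simple graph having $c$ as a toric chamber, with $\bar{\alpha}_G(c)=[\omega]$. Then for any pair $\{i,j\}\notin E$ of distinct vertices, either (i) $\{i,j\}$ is contained in a toric chain of $P$, in which case $c$ is also a toric chamber of $G^+=(V,E\cup\{\{i,j\}\})$ and there is a unique acyclic orientation $\omega^+$ of $G^+$ extending $\omega$ with $\bar{\alpha}_{G^+}(c)=[\omega^+]$; or (ii) $\{i,j\}$ is contained in no toric chain of $P$, in which case the set $\{x\in\mathbb{R}^V/\mathbb{Z}^V: x_i=x_j\}$ intersects $c$.
   Context: For a simple graph $G=(V,E)$, $\mathcal{A}_{\mathrm{tor}}(G)\subset\mathbb{R}^V/\mathbb{Z}^V$ is the image of the union of hyperplanes $\{x_i=x_j\}$, $\{i,j\}\in E$, under the quotient map; toric chambers are the connected components of its complement; a toric poset $P(c)$ is a set $c$ that is a toric chamber of some graph. $\{x_k\}\in[0,1)$ denotes fractional part. For $x$ off the arrangement, $\bar{\alpha}_G(x)$ directs $\{i,j\}\in E$ as $i\to j$ iff $\{x_i\}<\{x_j\}$; $\equiv$ is the equivalence on acyclic orientations generated by converting a source into a sink; $\bar{\alpha}_G(c)=[\omega]$ means $\bar{\alpha}_G(x)\equiv\omega$ for $x\in c$. A subset $C=\{i_1,\dots,i_m\}\subseteq V$ is a toric chain of $P(c)$ if there is a cyclic class $[(i_1,\dots,i_m)]$ of orderings of $C$ such that for every $x\in c$ some $(j_1,\dots,j_m)$ in that class satisfies $\{x_{j_1}\}<\dots<\{x_{j_m}\}$.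 *)

(* Defs.v *)
From Stdlib Require Import Relation_Operators.
From HB Require Import structures.
From mathcomp Require Import all_boot all_order all_algebra generic_quotient.
From mathcomp Require Import all_classical all_reals all_analysis.

Set Implicit Arguments.
Unset Strict Implicit.
Unset Printing Implicit Defensive.

Import Order.TTheory GRing.Theory Num.Theory.
Import numFieldNormedType.Exports.

Local Open Scope classical_set_scope.
Local Open Scope ring_scope.
Local Open Scope quotient_scope.

(* R^V with the product topology, and its quotient by Z^V with the quotient
   topology. *)
Section Torus.
Variables (R : realType) (V : finType).

Definition euclid : Type := {ptws V -> R}.

HB.instance Definition _ := Topological.copy euclid {ptws V -> R}.

Definition eqmodZ (x y : euclid) : bool :=
  [forall i, (x i - y i) \is a Num.int].

Lemma eqmodZ_refl : reflexive eqmodZ.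
Proof. by move=> x; apply/forallP => i; rewrite subrr rpred0. Qed.

Lemma eqmodZ_sym : symmetric eqmodZ.
Proof. by move=> x y; apply: eq_forallb => i; rewrite -opprB rpredN. Qed.

Lemma eqmodZ_trans : transitive eqmodZ.
Proof.
move=> y x z /forallP xy /forallP yz; apply/forallP => i.
by rewrite -(subrKA (y i)) rpredD.
Qed.

Canonical eqmodZ_equiv := EquivRel eqmodZ eqmodZ_refl eqmodZ_sym eqmodZ_trans.

Definition torus : Type := quotient_topology {eq_quot eqmodZ_equiv}.

HB.instance Definition _ :=
  Topological.copy torus (quotient_topology {eq_quot eqmodZ_equiv}).
HB.instance Definition _ :=
  Quotient.copy torus (quotient_topology {eq_quot eqmodZ_equiv}).

Definition torus_pi : euclid -> torus := \pi_torus.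

Definition frac (t : R) : R := t - (Num.floor t)%:~R.

(* The fractional part of the i-th coordinate of a point of the torus; by
   [tfrac_pi] it does not depend on the representative. *)
Definition tfrac (x : torus) (i : V) : R := frac ((repr x : euclid) i).

Lemma tfrac_pi (x : euclid) i : tfrac (torus_pi x) i = frac (x i).
Proof.
have : eqmodZ (repr (torus_pi x)) x.
  by apply/(@eqmodP _ eqmodZ_equiv); rewrite reprK.
move=> /forallP/(_ i) /intrP[m hm].
rewrite /tfrac /frac.
have -> : (repr (torus_pi x) : euclid) i = x i + m%:~R.
  by rewrite -hm addrC subrK.
by rewrite floorDrz ?intr_int// intrKfloor rmorphD/= opprD addrACA subrr addr0.
Qed.

Definition toric_hyperplane (i j : V) : set torus :=
  [set x | tfrac x i = tfrac x j].

Lemma toric_hyperplaneE i j :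
  toric_hyperplane i j = torus_pi @` [set x : euclid | x i = x j].
Proof.
apply/seteqP; split => [x /= xij|_ [x /= xij <-]]; last first.
  by rewrite /toric_hyperplane /= !tfrac_pi xij.
exists (fun k => tfrac x k) => //=; rewrite /torus_pi -[RHS]reprK.
apply/(@eqmodP _ eqmodZ_equiv)/forallP => k.
by rewrite /tfrac /frac addrAC subrr add0r rpredN intr_int.
Qed.

End Torus.

Section ToricPosets.
Variables (R : realType) (V : finType).
Local Notation torus := (torus R V).
Implicit Types (E : {set {set V}}) (w : {set V * V}) (c : set torus).

(* A simple graph on V is given by its set of edges, which are 2-element
   subsets of V. *)
Definition simple_graph E : Prop := forall e, e \in E -> #|e| = 2%N.

Definition toric_arrangement E : set torus :=
  @torus_pi R V @`
    \bigcup_(ij in [set ij : V * V | [set ij.1; ij.2]%SET \in E])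
      [set x : euclid R V | x ij.1 = x ij.2].

Definition toric_chamber E c : Prop :=
  exists2 x, (~` toric_arrangement E) x &
    c = connected_component (~` toric_arrangement E) x.

Definition toric_poset c : Prop := exists2 E, simple_graph E & toric_chamber E c.

(* Orientations are given by their set of arcs, (i, j) standing for i -> j. *)
Definition orientation E w : Prop :=
  (forall i j, (i, j) \in w -> [set i; j]%SET \in E) /\
  (forall i j, [set i; j]%SET \in E -> ((i, j) \in w) = ((j, i) \notin w)).

Definition acyclic w : Prop :=
  forall s : seq V, cycle [rel i j | (i, j) \in w] s -> s = [::].

Definition acyclic_orientation E w : Prop := orientation E w /\ acyclic w.

Definition source w k : Prop := forall i, (i, k) \notin w.

Definition reverse_at w k : {set V * V} :=
  [set a | if (a.1 == k) || (a.2 == k) then (a.2, a.1) \in w else a \in w]%SET.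

Definition source_to_sink E w w' : Prop :=
  acyclic_orientation E w /\ exists2 k, source w k & w' = reverse_at w k.

Definition toric_equiv E : {set V * V} -> {set V * V} -> Prop :=
  clos_refl_sym_trans _ (source_to_sink E).

Definition alpha_bar E (x : torus) : {set V * V} :=
  [set a | ([set a.1; a.2]%SET \in E) && (tfrac x a.1 < tfrac x a.2)]%SET.

(* alpha_bar_G(c) = [w] *)
Definition alpha_bar_class E c w : Prop :=
  forall x, c x -> toric_equiv E (alpha_bar E x) w.

(* The cyclic class of the ordering s consists of its rotations. *)
Definition toric_chain c (C : {set V}) : Prop :=
  exists s : seq V, [/\ uniq s, C = [set:: s]%SET &
    forall x, c x ->
      exists n : nat, sorted (fun i j => tfrac x i < tfrac x j) (rot n s)].

End ToricPosets.

(* Main.v *)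
From Stdlib Require Import Relation_Operators.
Require Import Defs.
From mathcomp Require Import all_boot all_order all_algebra generic_quotient.
From mathcomp Require Import all_classical all_reals all_analysis.
From mathcomp Require Import ring lra zify.

Set Implicit Arguments.
Unset Strict Implicit.
Unset Printing Implicit Defensive.

Import Order.TTheory GRing.Theory Num.Theory.
Import numFieldNormedType.Exports.
Local Open Scope ring_scope.

(** If c meets the hyperplane x_i = x_j, a point of the intersection rules out
    every toric chain through i and j.

    Otherwise c is a component of the smaller complement, hence a chamber of G+.
    Crossing an integer value of one coordinate inside c is exactly a source-sink
    flip; so the orientation class is constant on c and, conversely, every
    member of the class is the orientation of some point of c.  Let w be realized
    in c.  A lift w' of w with the class of c in G+ is also realized in c, and two
    points of c with orientation w lie on the same side of x_i = x_j, since the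
    segment between them stays in c: this is existence and uniqueness of w+.

    For the chain, rotate so that x_i = 0.  As c avoids x_i = x_j, the
    orientation has a directed path from i to j (else i could be raised to the
    height of j).  After flipping the source i into a sink there is likewise a
    path from j to i, whose last arc comes from an arc i -> a.  Together they give
    a path i -> .. -> j -> .. -> a closed by the arc i -> a, a configuration which
    flips only rotate; it is therefore a toric chain. *)

(** * Fractional parts and floors of reals *)

Section FractionalParts.
Variable R : realType.
Local Notation frac := (@Defs.frac R).
Implicit Types t : R.

Lemma frac_ge0 t : 0 <= frac t.
Proof. by rewrite subr_ge0 floor_le. Qed.

Lemma frac_lt1 t : frac t < 1.
Proof. by have := floorD1_gt t; rewrite /Defs.frac rmorphD /=; lra. Qed.

Lemma frac_id t : 0 <= t < 1 -> frac t = t.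
Proof.
move=> t01; rewrite /Defs.frac (@floor_def _ t 0) ?subr0//.
Qed.

Lemma fracDz t (n : int) : frac (t + n%:~R) = frac t.
Proof.
by rewrite /Defs.frac floorDrz ?intr_int// intrKfloor rmorphD/= opprD addrACA subrr addr0.
Qed.

Lemma frac_eq t u : frac t = frac u -> exists n : int, t = u + n%:~R.
Proof.
rewrite /Defs.frac => tu; exists (Num.floor t - Num.floor u).
by rewrite rmorphB /=; lra.
Qed.

(** Fractional parts differ by less than 1, so the floors differ by [n] or [n + 1]. This ties the
    direction of an arc to the floors of a lift. *)
Lemma floor_cell (s t : R) (n : int) : n%:~R < s - t < n%:~R + 1 ->
  (frac t < frac s /\ Num.floor s = Num.floor t + n) \/
  (frac s < frac t /\ Num.floor s = Num.floor t + n + 1).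
Proof.
move: (frac_ge0 s) (frac_lt1 s) (frac_ge0 t) (frac_lt1 t).
have := subrK (Num.floor s)%:~R s; have := subrK (Num.floor t)%:~R t.
rewrite -!/(frac _); set p := Num.floor s; set q := Num.floor t => tE sE.
move=> s0 s1 t0 t1 stn.
have /andP[lt1 lt2] : ((-1)%:~R < (p - q - n)%:~R :> R) && ((p - q - n)%:~R < 2%:~R :> R).
  by rewrite !rmorphB rmorphN1 /=; apply/andP; split; lra.
rewrite !ltr_int in lt1 lt2.
have [pE|pE] : p = q + n \/ p = q + n + 1 by lia.
  by left; split=> //; move: sE; rewrite pE rmorphD /=; lra.
by right; split=> //; move: sE; rewrite pE !rmorphD /=; lra.
Qed.

Lemma segment_itv (p q u v t : R) : 0 <= t <= 1 -> p < u < q -> p < v < q ->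
  p < u + t * (v - u) < q.
Proof.
move=> /andP[t0 t1] /andP[pu uq] /andP[pv vq].
have [uv|/ltW uv] := leP u v.
  have : 0 <= t * (v - u) <= v - u by rewrite mulr_ge0 ?subr_ge0// ler_piMl ?subr_ge0.
  by lra.
have : 0 <= t * (u - v) <= u - v by rewrite mulr_ge0 ?subr_ge0// ler_piMl ?subr_ge0.
by lra.
Qed.

End FractionalParts.

(** * Lifted cells and toric chambers *)

Section ToricChambers.
Variables (R : realType) (V : finType).
Local Notation euclid := (euclid R V).
Local Notation torus := (torus R V).
Local Notation pi := (@torus_pi R V).
Implicit Types (E : {set {set V}}) (w : {set V * V}) (c : set torus)
  (x y : euclid) (z : torus) (a b k : V).

Lemma tfrac_ge0 z a : 0 <= tfrac z a.
Proof. exact: frac_ge0. Qed.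

Lemma tfrac_lt1 z a : tfrac z a < 1.
Proof. exact: frac_lt1. Qed.

Lemma tfracK z : pi (tfrac z) = z.
Proof.
rewrite /torus_pi -[RHS]reprK; apply/(@eqmodP _ (eqmodZ_equiv R V))/forallP => k.
by rewrite /tfrac /Defs.frac addrAC subrr add0r rpredN intr_int.
Qed.

Lemma tfrac_pi_id x a : 0 <= x a < 1 -> tfrac (pi x) a = x a.
Proof. by move=> xa; rewrite tfrac_pi frac_id. Qed.

Lemma toric_arrangementP E z :
  toric_arrangement E z <-> exists a b, [set a; b]%SET \in E /\ tfrac z a = tfrac z b.
Proof.
split=> [[x [[a b] /= abE xab] <-]|[a [b [abE zab]]]].
  by exists a, b; rewrite !tfrac_pi xab.
exists (tfrac z); last exact: tfracK.
by exists (a, b).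
Qed.

(* [x] and [y] lie in the same (open, convex) cell of the lifted arrangement of
   all hyperplanes [x_a - x_b = n]. *)
Definition same_cell E x y : Prop := forall a b, [set a; b]%SET \in E ->
  exists n : int, (n%:~R < x a - x b < n%:~R + 1) /\ (n%:~R < y a - y b < n%:~R + 1).

(** On the diagonal, [same_cell] says that no edge difference is an integer. *)
Lemma off_arrangement E x :
  (~` toric_arrangement E)%classic (pi x) <-> same_cell E x x.
Proof.
split=> [xE a b abE|xE /toric_arrangementP[a [b [abE]]]].
  exists (Num.floor (x a - x b)).
  suff : (Num.floor (x a - x b))%:~R != x a - x b.
    have := floor_le (x a - x b); have := floorD1_gt (x a - x b).
    rewrite rmorphD /= => -> le1 ne1; rewrite lt_neqAle ne1 le1 //.
  apply/negP => /eqP xab; apply: xE; apply/toric_arrangementP; exists a, b.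
  split=> //; rewrite !tfrac_pi -(fracDz (x b) (Num.floor (x a - x b))) xab.
  by rewrite addrC subrK.
rewrite !tfrac_pi => /frac_eq[m xab].
have [n [/andP[]]] := xE a b abE.
rewrite xab addrC addKr -[1]/(1%:~R) -rmorphD /= !ltr_int => nm mn.
by rewrite ltzD1 leNgt nm in mn.
Qed.

Lemma torus_pi_continuous : continuous pi.
Proof. exact: pi_continuous. Qed.

Lemma euclid_proj_continuous a : continuous (fun x : euclid => x a).
Proof. exact: (@proj_continuous V (fun=> R) a). Qed.

Lemma to_euclid_continuous (f : R -> euclid) :
  (forall a, continuous (fun t => f t a)) -> continuous f.
Proof.
move=> fc t; apply/cvg_sup => a.
apply: (@continuous_comp_initial (V -> R) R R (fun x => x a) f (fc a) t).
Qed.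

Lemma chamber_off E c : toric_chamber E c -> (c `<=` ~` toric_arrangement E)%classic.
Proof. by move=> [x _ ->]; exact: connected_component_sub. Qed.

Lemma chamber_connected E c : toric_chamber E c -> connected c.
Proof. by move=> [x _ ->]; exact: component_connected. Qed.

Lemma chamber_max E c (B : set torus) z : toric_chamber E c -> c z -> B z ->
  (B `<=` ~` toric_arrangement E)%classic -> connected B -> (B `<=` c)%classic.
Proof.
move=> [x _ ->] /same_connected_component -> Bz BE Bc.
exact: connected_component_max.
Qed.

(** Cells are convex: the segment from [x] to [y] projects to a connected set off the arrangement,
    which maximality of the component puts inside [c]. *)
Lemma same_cell_chamber E c x y :
  toric_chamber E c -> same_cell E x y -> c (pi x) -> c (pi y).
Proof.
move=> cE xy cx.
pose f (t : R) : euclid := fun a => x a + t * (y a - x a).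
have fC : continuous f.
  apply: to_euclid_continuous => a t.
  by apply: cvgD; [exact: cvg_cst|apply: cvgMl; exact: cvg_id].
have f0 : f 0 = x by apply/funext => a; rewrite /f mul0r addr0.
have f1 : f 1 = y by apply/funext => a; rewrite /f mul1r addrC subrK.
have := @chamber_max E c ((pi \o f) @` `[0, 1]%classic) (pi x) cE cx; apply.
- by exists 0; rewrite /= ?f0// in_itv /= lexx ler01.
- move=> _ [t /= t01 <-]; apply/off_arrangement => a b abE.
  have [n [xn yn]] := xy a b abE.
  exists n; suff : n%:~R < f t a - f t b < n%:~R + 1 by [].
  move: t01; rewrite in_itv /= => t01; have := segment_itv t01 xn yn.
  rewrite /f; lra.
- apply: connected_continuous_connected; first exact: segment_connected.
  apply: continuous_subspaceT => t.
  by apply: continuous_comp; [exact: fC|exact: torus_pi_continuous].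
- by exists 1; rewrite /= ?f1// in_itv /= lexx ler01.
Qed.

Lemma off_tfrac E z a b : (~` toric_arrangement E)%classic z ->
  [set a; b]%SET \in E -> (tfrac z b < tfrac z a) = ~~ (tfrac z a < tfrac z b).
Proof.
move=> zE abE; rewrite -leNgt lt_neqAle andb_idl // => _.
by apply/eqP => ab; apply: zE; apply/toric_arrangementP; exists a, b.
Qed.

Lemma off_tfrac_lt E z a b : (~` toric_arrangement E)%classic z ->
  [set a; b]%SET \in E -> tfrac z a < tfrac z b \/ tfrac z b < tfrac z a.
Proof.
by move=> zE abE; rewrite (off_tfrac zE abE); apply/orP; rewrite orbN.
Qed.

(** For representatives in [[0, 1)] an edge difference lies in [(-1, 0)] or [(0, 1)] according to
    the arc, so the orientation determines the cell. *)
Lemma mono_chamber E c z y : toric_chamber E c -> c z ->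
  (forall a, 0 <= y a < 1) ->
  (forall a b, [set a; b]%SET \in E -> tfrac z a < tfrac z b -> y a < y b) ->
  c (pi y).
Proof.
move=> cE cz y01 zy; apply: (@same_cell_chamber E _ (tfrac z)) => //; last first.
  by rewrite tfracK.
move=> a b abE; have baE : [set b; a]%SET \in E by rewrite finset.setUC.
move: (off_tfrac_lt (chamber_off cE cz) abE) (zy a b abE) (zy b a baE).
move: (y01 a) (y01 b) (tfrac_ge0 z a) (tfrac_ge0 z b) (tfrac_lt1 z a) (tfrac_lt1 z b).
move=> ? ? ? ? ? ? [ab|ab] hab hba.
  by move: (hab ab); exists (-1); rewrite rmorphN1; split; lra.
by move: (hba ab); exists 0; rewrite mulr0z; split; lra.
Qed.

Lemma alpha_bar_acyclic E z : (~` toric_arrangement E)%classic z ->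
  acyclic_orientation E (alpha_bar E z).
Proof.
move=> zE; split; first split=> a b; first by rewrite inE => /andP[].
  by move=> abE; rewrite !inE /= abE finset.setUC abE /= (off_tfrac zE abE) negbK.
case=> [//|a p] /= pc.
have {pc} : path (relpre (tfrac z) <%O) a (rcons p a).
  by apply: sub_path pc => u v; rewrite /= inE => /andP[].
move/(order_path_min (fun _ _ _ => @lt_trans _ _ _ _ _))/allP/(_ a).
by rewrite mem_rcons mem_head /= ltxx => /(_ isT).
Qed.

(** * Realizing flips inside a chamber *)

(** A source lies below all its neighbours, so it can be lowered through 0 without meeting an edge
    hyperplane. *)
Lemma source_to_sink_real E c z k : toric_chamber E c -> c z ->
  source (alpha_bar E z) k ->
  exists2 z', c z' & alpha_bar E z' = reverse_at (alpha_bar E z) k.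
Proof.
move=> cE cz ks.
have klt a : [set a; k]%SET \in E -> tfrac z k < tfrac z a.
  move=> akE; rewrite (off_tfrac (chamber_off cE cz)) //.
  by apply: contra (ks a) => h; rewrite inE /= akE.
(* Halving keeps the other coordinates in [[0, 1/2)]; [-1/4] has fractional part [3/4], above them
   all. *)
pose y : euclid := fun a => if a == k then - 4^-1 else tfrac z a / 2.
have ty a : tfrac (pi y) a = if a == k then 3 / 4 else tfrac z a / 2.
  move: (tfrac_ge0 z a) (tfrac_lt1 z a) => ? ?.
  rewrite tfrac_pi /y; case: eqP => _; last by rewrite frac_id//; lra.
  by rewrite -(fracDz _ 1) mulr1z frac_id; lra.
exists (pi y).
  apply: (@same_cell_chamber E _ (tfrac z)) => //; last by rewrite tfracK.
  move=> a b abE; have baE : [set b; a]%SET \in E by rewrite finset.setUC.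
  move: abE baE (klt a) (klt b) (off_tfrac_lt (chamber_off cE cz) abE).
  move: (tfrac_ge0 z a) (tfrac_ge0 z b) (tfrac_lt1 z a) (tfrac_lt1 z b).
  rewrite /y; case: eqP => [->|_]; case: eqP => [->|_] ? ? ? ? abE baE ha hb hab.
  - by move: (ha abE); rewrite ltxx.
  - by move: (hb baE); exists (-1); rewrite rmorphN1; split; lra.
  - by move: (ha abE); exists 0; rewrite mulr0z; split; lra.
  - case: hab => ?; [exists (-1)|exists 0].
      by rewrite rmorphN1; split; lra.
    by rewrite mulr0z; split; lra.
apply/setP => -[a b]; rewrite !inE /= !ty.
move: (klt a) (klt b).
move: (tfrac_ge0 z a) (tfrac_ge0 z b) (tfrac_lt1 z a) (tfrac_lt1 z b).
case: eqP => [->|_]; case: eqP => [->|_] /= ? ? ? ? ha hb.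
- by rewrite !ltxx.
- rewrite finset.setUC; case: (boolP (_ \in E)) => //= bE.
  by move: (hb bE) => hb'; rewrite ![_ < _]ltNge; congr negb; apply/idP/idP; lra.
- rewrite [[set k; a]%SET]finset.setUC; case: (boolP (_ \in E)) => //= aE.
  by move: (ha aE) => ha'; apply/idP/idP; lra.
- by case: (_ \in E) => //=; apply/idP/idP; lra.
Qed.

(** The inverse move: [k] is a sink at [z] and is raised to the next integer. *)
Lemma sink_to_source_real E c z w k : toric_chamber E c -> c z ->
  acyclic_orientation E w -> source w k -> alpha_bar E z = reverse_at w k ->
  exists2 z', c z' & alpha_bar E z' = w.
Proof.
move=> cE cz [[wE wor] _] ks zw.
have klt a : [set a; k]%SET \in E -> tfrac z a < tfrac z k.
  move=> akE; have : (a, k) \in alpha_bar E z; last by rewrite inE => /andP[].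
  by rewrite zw inE /= eqxx orbT wor ?ks// finset.setUC.
(* The other coordinates are squeezed into [[1/2, 1)], while 1 has fractional part 0. *)
pose y : euclid := fun a => if a == k then 1 else (tfrac z a + 1) / 2.
have ty a : tfrac (pi y) a = if a == k then 0 else (tfrac z a + 1) / 2.
  move: (tfrac_ge0 z a) (tfrac_lt1 z a) => ? ?.
  rewrite tfrac_pi /y; case: eqP => _; last by rewrite frac_id//; lra.
  by rewrite -(fracDz _ (-1)) mulrN1z subrr frac_id; lra.
exists (pi y).
  apply: (@same_cell_chamber E _ (tfrac z)) => //; last by rewrite tfracK.
  move=> a b abE; have baE : [set b; a]%SET \in E by rewrite finset.setUC.
  move: abE baE (klt a) (klt b) (off_tfrac_lt (chamber_off cE cz) abE).
  move: (tfrac_ge0 z a) (tfrac_ge0 z b) (tfrac_lt1 z a) (tfrac_lt1 z b).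
  rewrite /y; case: eqP => [->|_]; case: eqP => [->|_] ? ? ? ? abE baE ha hb hab.
  - by move: (ha abE); rewrite ltxx.
  - by move: (hb baE); exists 0; rewrite mulr0z; split; lra.
  - by move: (ha abE); exists (-1); rewrite rmorphN1; split; lra.
  - case: hab => ?; [exists (-1)|exists 0].
      by rewrite rmorphN1; split; lra.
    by rewrite mulr0z; split; lra.
have wk a : (k, a) \in w = ([set a; k]%SET \in E).
  apply/idP/idP => [/wE|]; first by rewrite finset.setUC.
  by move=> akE; rewrite wor ?ks// finset.setUC.
apply/setP => -[a b]; rewrite !inE /= !ty.
move: (klt a) (klt b) (tfrac_ge0 z a) (tfrac_ge0 z b).
case: (altP (a =P k)) => [->|ak]; case: (altP (b =P k)) => [->|bk] /= ha hb ? ?.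
- by rewrite ltxx andbF (negbTE (ks k)).
- rewrite wk finset.setUC; case: (_ \in E) => //=; lra.
- rewrite (negbTE (ks a)); apply/negP => /andP[_]; lra.
- have := congr1 (fun w : {set V * V} => (a, b) \in w) zw.
  rewrite !inE /= (negbTE ak) (negbTE bk) /= => <-.
  by case: (_ \in E) => //=; apply/idP/idP; lra.
Qed.

Lemma toric_equiv_real E c w w' : toric_chamber E c -> toric_equiv E w w' ->
  (exists2 z, c z & alpha_bar E z = w) <-> (exists2 z, c z & alpha_bar E z = w').
Proof.
move=> cE; elim=> {w w'} [w w' [wac [k ks ->]]|//|w w' _ -> //|w1 w2 w3 _ -> _ -> //].
split=> -[z cz zw].
  have [|z' cz' z'E] := @source_to_sink_real E c z k cE cz; first by rewrite zw.
  by exists z'; rewrite // z'E zw.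
by have [z' ? ?] := sink_to_source_real cE cz wac ks zw; exists z'.
Qed.

(** * Constancy of the orientation class on a chamber *)

(** The integer [n] is common to a cell, so by [floor_cell] the floors alone decide every arc. *)
Lemma alpha_bar_same_floor E x y : same_cell E x y ->
  (forall a, Num.floor (y a) = Num.floor (x a)) ->
  alpha_bar E (pi y) = alpha_bar E (pi x).
Proof.
move=> xy fl; apply/setP => -[a b]; rewrite !inE /= !tfrac_pi.
case: (boolP (_ \in E)) => //= abE.
have [n [/floor_cell xn /floor_cell yn]] := xy a b abE.
move: xn yn; rewrite !fl => -[[lt1 eq1]|[lt1 eq1]] [[lt2 eq2]|[lt2 eq2]].
- by rewrite !ltNge !ltW.
- by exfalso; lia.
- by exfalso; lia.
- by rewrite lt1 lt2.
Qed.

(* Moving [x_k] up past an integer inside a cell turns the sink [k] into a source. *)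
Lemma alpha_bar_floor_incr E x y k : same_cell E x y ->
  (forall a, a != k -> Num.floor (y a) = Num.floor (x a)) ->
  Num.floor (y k) = Num.floor (x k) + 1 ->
  source_to_sink E (alpha_bar E (pi y)) (alpha_bar E (pi x)).
Proof.
move=> xy fl flk.
(* A loop at [k] would put 0 strictly between consecutive integers. *)
have kk : [set k; k]%SET \notin E.
  by apply/negP => /xy[n]; rewrite subrr -[1]/(1%:~R) -!rmorphD -[0]/(0%:~R) !ltr_int; lia.
(* With [n] fixed, raising the floor at [k] switches the alternative of [floor_cell], which reverses
   the arc. *)
have nbr a : a != k -> [set a; k]%SET \in E ->
    tfrac (pi x) a < tfrac (pi x) k /\ tfrac (pi y) k < tfrac (pi y) a.
  move=> ak /xy[n [/floor_cell xn /floor_cell yn]]; move: xn yn.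
  rewrite !tfrac_pi fl// flk => -[[lt1 eq1]|[lt1 eq1]] [[lt2 eq2]|[lt2 eq2]];
    by [split|exfalso; lia].
split; first apply: alpha_bar_acyclic.
  apply/off_arrangement => a b /xy[n [_ yn]]; by exists n.
exists k.
  move=> a; rewrite inE /=; apply/negP => /andP[akE].
  have [ak|ak] := eqVneq a k; first by rewrite ak (negbTE kk) in akE.
  by rewrite ltNge ltW// (nbr a ak akE).2.
apply/setP => -[a b]; rewrite !inE /=.
have [->|ak] := eqVneq a k; have [->|bk] := eqVneq b k => /=.
- by rewrite (negbTE kk).
- rewrite finset.setUC; case: (boolP (_ \in E)) => //= bE.
  by have [lt1 lt2] := nbr b bk bE; rewrite !ltNge !ltW.
- rewrite [[set k; a]%SET]finset.setUC; case: (boolP (_ \in E)) => //= aE.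
  by have [-> ->] := nbr a ak aE.
- case: (boolP (_ \in E)) => //= abE.
  have [n [/floor_cell xn /floor_cell yn]] := xy a b abE.
  move: xn yn; rewrite !fl// !tfrac_pi => -[[lt1 eq1]|[lt1 eq1]] [[lt2 eq2]|[lt2 eq2]].
  + by rewrite !ltNge !ltW.
  + by exfalso; lia.
  + by exfalso; lia.
  + by rewrite lt1 lt2.
Qed.

(** Local constancy of the class, the input to the connectedness argument on [c]. *)
Lemma near_alpha_bar E x : same_cell E x x ->
  \forall y \near x, same_cell E y y /\
    toric_equiv E (alpha_bar E (pi y)) (alpha_bar E (pi x)).
Proof.
move=> xE.
(* Coordinates moving by less than [d] change a difference by less than [2 * d], so the cell is
   kept; [d < 1] lets each floor change by at most one. *)
have [d [d0 d1 dE]] : exists d : R, [/\ 0 < d, d < 1 &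
    forall a b, [set a; b]%SET \in E ->
    exists n : int, n%:~R + 2 * d < x a - x b < n%:~R + 1 - 2 * d].
  near (at_right (0 : R)) => d; exists d; split=> //.
  near: d; apply: filter_forall => a; apply: filter_forall => b.
  have [/xE[n [/andP[n1 n2] _]]|_] := boolP ([set a; b]%SET \in E); last exact: nearW.
  near=> d => _; exists n.
  have : d < (x a - x b - n%:~R) / 2 by near: d; apply: nbhs_right_lt; lra.
  have : d < (n%:~R + 1 - (x a - x b)) / 2 by near: d; apply: nbhs_right_lt; lra.
  lra.
have box : \forall y \near x, forall a, `|x a - y a| < d.
  have FF : Filter (nbhs x) by apply: (@nbhs_filter euclid).
  apply: (@filter_forall euclid V (fun a y => `|x a - y a| < d) (nbhs x)) => a.
  move: (@euclid_proj_continuous a x) => /cvgrPdist_lt /(_ d d0) xa.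
  exact: xa.
apply: filterS box => y yd.
(* Pass from [x] to [y] one coordinate at a time; each step is a flip or nothing. *)
pose z (s : seq V) : euclid := fun a => if a \in s then y a else x a.
have zE s t : same_cell E (z s) (z t).
  move=> a b abE; have [n n12] := dE a b abE; exists n.
  move: (yd a) (yd b) n12; rewrite !ltr_norml /z => ? ? ?.
  by split; case: ifP => _; case: ifP => _; lra.
have zy : z (enum V) = y by apply/funext => a; rewrite /z mem_enum.
split; first by rewrite -zy; exact: zE.
rewrite -zy; elim: (enum V) => [|k s IH]; first exact: rst_refl.
apply: rst_trans IH; have [ks|ks] := boolP (k \in s).
  suff -> : z (k :: s) = z s by exact: rst_refl.
  by apply/funext => a; rewrite /z inE; case: eqP => [->|//]; rewrite ks.
have zs a : a != k -> z (k :: s) a = z s a by move=> /negbTE ak; rewrite /z inE ak.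
have /andP[lt1 lt2] : (Num.floor (x k) - 1 - 1)%:~R < ((Num.floor (y k))%:~R : R)
    < (Num.floor (x k) + 1 + 1)%:~R.
  rewrite !(rmorphD, rmorphB) /=.
  move: (floor_le (x k)) (floorD1_gt (x k)) (floor_le (y k)) (floorD1_gt (y k)) (yd k).
  by rewrite ltr_norml !rmorphD /=; lra.
rewrite !ltr_int in lt1 lt2.
have zk1 : z (k :: s) k = y k by rewrite /z mem_head.
have zk2 : z s k = x k by rewrite /z (negbTE ks).
have [e|[e|e]] : Num.floor (y k) = Num.floor (x k) \/ Num.floor (y k) = Num.floor (x k) + 1
  \/ Num.floor (x k) = Num.floor (y k) + 1 by lia.
- rewrite (@alpha_bar_same_floor _ (z s)); [exact: rst_refl|exact: zE|] => a.
  by have [->|/zs ->//] := eqVneq a k; rewrite zk1 zk2.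
- apply: rst_step; apply: (@alpha_bar_floor_incr _ _ _ k) => // [a /zs ->//|].
  by rewrite zk1 zk2.
- apply: rst_sym; apply: rst_step.
  apply: (@alpha_bar_floor_incr _ _ _ k) => // [a /zs ->//|].
  by rewrite zk1 zk2.
Unshelve. all: by end_near.
Qed.

(** The points of [c] with the class of [z] form a nonempty set, open and closed in the connected
    set [c]. *)
Lemma chamber_toric_equiv E c z z' : toric_chamber E c -> c z -> c z' ->
  toric_equiv E (alpha_bar E z') (alpha_bar E z).
Proof.
move=> cE cz cz'.
pose U (P : {set V * V} -> Prop) : set torus :=
  [set u | (~` toric_arrangement E)%classic u /\ P (alpha_bar E u)]%classic.
have Uo (P : {set V * V} -> Prop) :
    (forall w w', toric_equiv E w' w -> P w -> P w') -> open (U P).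
  (* In the quotient topology, openness is tested on the preimage. *)
  move=> Pinv; suff : open (pi @^-1` U P)%classic by [].
  rewrite openE => x [/off_arrangement xE Px].
  apply: filterS (near_alpha_bar xE) => y [yE yx]; split.
    exact/off_arrangement.
  exact: Pinv yx Px.
pose P w := toric_equiv E w (alpha_bar E z).
have Pinv w w' : toric_equiv E w' w -> P w -> P w' by exact: rst_trans.
have cUP : (c `&` U P = c)%classic.
  apply: (chamber_connected cE).
  - exists z; split=> //; split; first exact: (chamber_off cE).
    exact: rst_refl.
  - by exists (U P) => //; exact: Uo.
  - exists (~` U (fun w => ~ P w))%classic.
      apply: open_closedC; apply: Uo => w w' ww' Pw Pw'; apply: Pw.
      by apply: Pinv Pw'; exact: rst_sym.
    apply/seteqP; split => u [cu uU]; split=> //; first by move=> [_]; apply; case: uU.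
    have uE := chamber_off cE cu; split=> //.
    by apply: contrapT => Pu; apply: uU.
by have [_ []] : (c `&` U P)%classic z' by rewrite cUP.
Qed.

(** * Toric directed paths and toric chains *)

(** A toric directed path. The closing arc runs from the first vertex to the last, parallel to the
    path, since an acyclic orientation has no closed one. *)
Definition cyclically_directed w (s : seq V) : Prop := exists n r p,
  [/\ rot n s = r :: p, path [rel a b | (a, b) \in w] r p & (r, last r p) \in w].

Lemma rot_rot_ex (T : Type) m n (s : seq T) : exists l, rot m (rot n s) = rot l s.
Proof.
rewrite (rot_minn n) (rot_minn m) size_rot.
by rewrite rot_add_mod ?geq_minr//; eexists.
Qed.

Lemma reverse_at_out w k a : ((k, a) \in reverse_at w k) = ((a, k) \in w).
Proof. by rewrite inE /= eqxx. Qed.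

Lemma reverse_at_in w k a : ((a, k) \in reverse_at w k) = ((k, a) \in w).
Proof. by rewrite inE /= eqxx orbT. Qed.

Lemma reverse_at_path w k r p : k \notin r :: p ->
  path [rel a b | (a, b) \in reverse_at w k] r p = path [rel a b | (a, b) \in w] r p.
Proof.
move=> krp; apply: (@eq_in_path _ (predC1 k)) => [a b /= ak bk|].
  by rewrite !inE /= in ak bk *; rewrite (negbTE ak) (negbTE bk).
by apply/allP => a arp; apply: contra krp => /eqP <-.
Qed.

(** A flip off [s] leaves its arcs alone. A flipped source on [s] moves from the front to the end:
    the closing arc becomes the last path arc, and the first path arc becomes the closing one. *)
Lemma cyclically_directed_flip E w w' s : uniq s -> source_to_sink E w w' ->
  cyclically_directed w s <-> cyclically_directed w' s.
Proof.
move=> us [_ [k ks ->]].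
have ud n r p : rot n s = r :: p -> uniq (r :: p) by move=> <-; rewrite rot_uniq.
split=> -[n [r [p [sE pw rw]]]]; have := ud _ _ _ sE; have krp := boolP (k \in r :: p).
- case: krp => krp urp; last first.
    exists n, r, p; split=> //; first by rewrite reverse_at_path.
    move: krp; rewrite inE => /norP[kr kp].
    have kl : k != last r p.
      apply: contra (_ : k \notin r :: p); last by rewrite inE negb_or kr.
      by move=> /eqP ->; exact: mem_last.
    by rewrite inE /= eq_sym (negbTE kr) eq_sym (negbTE kl).
  (* Every later vertex has an incoming path arc, so a source is the first vertex. *)
  have kr : k = r.
    move: krp; rewrite inE => /predU1P[//|kp].
    move: pw; case/splitPr: kp => p1 p2; rewrite cat_path /= => /and3P[_ lk _].
    by have := ks (last r p1); rewrite lk.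
  subst r; case: p => [|r p] in sE pw rw urp krp *; first by have := ks k; rewrite rw.
  have [m mE] := rot_rot_ex 1 n s.
  exists m, r, (rcons p k); rewrite -mE sE last_rcons reverse_at_in.
  move: pw urp => /= /andP[kr rp] /andP[krp' _].
  rewrite rot1_cons rcons_path reverse_at_path// rp /= reverse_at_in; split=> //.
- case: krp => krp urp; last first.
    exists n, r, p; split=> //; first by rewrite -(reverse_at_path _ krp).
    move: krp rw; rewrite inE => /norP[kr kp].
    have kl : k != last r p.
      apply: contra (_ : k \notin r :: p); last by rewrite inE negb_or kr.
      by move=> /eqP ->; exact: mem_last.
    by rewrite inE /= eq_sym (negbTE kr) eq_sym (negbTE kl).
  (* Conversely [k] is now a sink, hence the last vertex of the path, and is brought back to the
     front. *)
  have kout a : (k, a) \notin reverse_at w k by rewrite reverse_at_out.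
  have kr : k != r by apply/eqP => kr; have := kout (last r p); rewrite {1}kr rw.
  move: krp; rewrite inE (negbTE kr) /= => kp.
  move: sE pw rw urp; case/path.splitP: kp => p1 p2 sE pw rw urp.
  case: p2 => [|b p2] in sE pw rw urp *; last first.
    move: pw; rewrite cat_path /= last_rcons.
    by rewrite (negbTE (kout b)) andbF.
  rewrite cats0 in sE pw rw urp.
  have [m mE] := rot_rot_ex (size p1).+1 n s.
  exists m, k, (r :: p1); rewrite -mE sE.
  move: pw rw urp; rewrite rcons_path last_rcons !reverse_at_in /= mem_rcons inE rcons_uniq.
  move=> /andP[pw lk] rw /andP[/norP[rk rp1] /andP[kp1 up1]].
  split=> /=; last by rewrite -reverse_at_in.
    by rewrite -rcons_cons -cats1 -[(size p1).+1]/(size (r :: p1)) rot_size_cat.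
  by rewrite rw -(reverse_at_path _ (_ : k \notin r :: p1))// inE negb_or kr.
Qed.

Lemma cyclically_directed_equiv E w w' s : uniq s -> toric_equiv E w w' ->
  cyclically_directed w s <-> cyclically_directed w' s.
Proof.
move=> us; elim=> {w w'} [w w' ww'|//|w w' _ -> //|w1 w2 w3 _ -> _ -> //].
exact: cyclically_directed_flip ww'.
Qed.

(** By constancy of the class the configuration persists, up to rotation, at every point of [c], and
    coordinates increase along its path. *)
Lemma cyclically_directed_chain E c z (s : seq V) : toric_chamber E c -> c z ->
  uniq s -> cyclically_directed (alpha_bar E z) s -> toric_chain c [set:: s]%SET.
Proof.
move=> cE cz us sz; exists s; split=> // z' cz'.
have [n [r [p [sE pw _]]]] :=
  (cyclically_directed_equiv us (chamber_toric_equiv cE cz cz')).2 sz.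
exists n; rewrite sE /=; apply: sub_path pw => a b /=.
by rewrite inE => /andP[].
Qed.

(** * Directed paths forced by an avoided hyperplane *)

Lemma alpha_bar_path_uniq E z a p :
  path [rel a b | (a, b) \in alpha_bar E z] a p -> uniq (a :: p).
Proof.
move=> pa; apply: (@map_uniq _ _ (tfrac z)); apply: lt_sorted_uniq.
rewrite /= path_map; apply: sub_path pa => u v /=.
by rewrite inE => /andP[].
Qed.

(* Raising the descendants of [i] until [i] reaches the height of [j] preserves
   the orientation, unless [j] is itself a descendant of [i]. *)
Lemma chamber_connect E c z i j : toric_chamber E c -> c z ->
  (forall z', c z' -> tfrac z' i <> tfrac z' j) -> tfrac z i < tfrac z j ->
  connect [rel a b | (a, b) \in alpha_bar E z] i j.
Proof.
move=> cE cz cij ij; apply: contrapT => nij.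
pose D := connect [rel a b | (a, b) \in alpha_bar E z] i.
(* Chosen so that the map sending [t] to [t + (1 - t) * l] takes [tfrac z i] to [tfrac z j]; as
   [0 <= l < 1], it raises values, keeps their order and stays below 1. *)
pose l := (tfrac z j - tfrac z i) / (1 - tfrac z i).
have i1 := tfrac_lt1 z i; have j1 := tfrac_lt1 z j; have i0 := tfrac_ge0 z i.
have l1 : l < 1 by rewrite /l ltr_pdivrMr; lra.
have l0 : 0 <= l by rewrite /l divr_ge0; lra.
pose y : euclid := fun a => if D a then tfrac z a + (1 - tfrac z a) * l else tfrac z a.
have y01 a : 0 <= y a < 1.
  have := tfrac_ge0 z a; have := tfrac_lt1 z a.
  by rewrite /y; case: (D a); nra.
apply: (cij (pi y)).
  apply: (mono_chamber cE cz y01) => a b abE ab.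
  have Dab : D a -> D b.
    by move=> Da; apply: connect_trans Da (connect1 _); rewrite /= inE /= abE.
  have a0 := tfrac_ge0 z a; have b1 := tfrac_lt1 z b; move: Dab.
  by rewrite /y; case: (D a); case: (D b) => Dab; [nra|by have := Dab isT|nra|exact: ab].
rewrite !tfrac_pi_id// /y /D connect0 (negbTE (introN idP nij)) /l.
by field; lra.
Qed.

(** Subtracting one constant from all coordinates of a lift preserves the differences, hence the
    cell. *)
Lemma chamber_rotate E c i : toric_chamber E c -> exists2 z, c z & tfrac z i = 0.
Proof.
move=> cE; have [x xE cx] := cE.
pose y : euclid := fun a => tfrac x a - tfrac x i.
exists (pi y); last by rewrite tfrac_pi /y subrr frac_id// lexx ltr01.
apply: (@same_cell_chamber E _ (tfrac x)) => //; last first.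
  by rewrite tfracK cx; exact: connected_component_refl.
move=> a b abE; have /off_arrangement : (~` toric_arrangement E)%classic (pi (tfrac x)).
  by rewrite tfracK.
move=> /(_ a b abE)[n [xn _]]; exists n; split=> //.
by move: xn; rewrite /y; lra.
Qed.

Lemma chamber_chain E c i j : toric_chamber E c -> i <> j ->
  (forall z, c z -> tfrac z i <> tfrac z j) ->
  exists2 C : {set V}, toric_chain c C & [set i; j]%SET \subset C.
Proof.
move=> cE ij cij; have [z cz zi] := chamber_rotate i cE.
have zij : tfrac z i < tfrac z j.
  by rewrite zi lt_neqAle tfrac_ge0 andbT; apply/eqP; rewrite -zi; exact: cij.
have isrc : source (alpha_bar E z) i.
  by move=> a; rewrite inE /= zi ltNge tfrac_ge0 andbF.
have [z' cz' z'E] := source_to_sink_real cE cz isrc.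
have iout a : (i, a) \notin alpha_bar E z' by rewrite z'E reverse_at_out.
(* Otherwise [chamber_connect] would give a path leaving [i], which is now a sink. *)
have z'ji : tfrac z' j < tfrac z' i.
  rewrite lt_neqAle; apply/andP; split; first by apply/eqP => /esym; exact: cij.
  rewrite leNgt; apply/negP => /(chamber_connect cE cz' cij)/connectP[[|a p] /=].
    by move=> _ /esym.
  by rewrite (negbTE (iout a)).
have [p ip jE] := connectP (chamber_connect cE cz cij zij).
have cji z0 : c z0 -> tfrac z0 j <> tfrac z0 i by move=> /cij + /esym.
have [q0 jq0 iE0] := connectP (chamber_connect cE cz' cji z'ji).
(* Once shortened, the path meets [i] only at its end. The part before [i] is then unaffected by the
   flip, and its last arc [a -> i] was [i -> a] at [z]. *)
case/shortenP: jq0 iE0 => q jq uq _ iE.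
case/lastP: q => [|q a] in jq uq iE; first by move: ij; rewrite iE.
rewrite last_rcons in iE; rewrite -iE -rcons_cons rcons_uniq rcons_path z'E in jq uq.
move/andP: jq => [jq ia]; move/andP: uq => [ijq _]; rewrite /= reverse_at_in in ia.
rewrite reverse_at_path// in jq.
have ipq : path [rel a b | (a, b) \in alpha_bar E z] i (p ++ q).
  by rewrite cat_path ip -jE.
have upq := alpha_bar_path_uniq ipq.
exists [set:: i :: p ++ q]%SET.
  apply: (cyclically_directed_chain cE cz upq).
  by exists 0%N, i, (p ++ q); rewrite rot0 last_cat -jE.
apply/fintype.subsetP => b; rewrite !inE => /orP[->//|/eqP ->].
have : j \in i :: p by rewrite jE mem_last.
by rewrite mem_cat inE => /orP[->//|->]; rewrite orbT.
Qed.

(** * Chains, the added edge and the sides of its hyperplane *)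

(** Coordinates increase strictly along some rotation of the chain, so they are injective on it. *)
Lemma chain_no_hyperplane c (C : {set V}) z i j : toric_chain c C -> c z ->
  i <> j -> [set i; j]%SET \subset C -> tfrac z i <> tfrac z j.
Proof.
move=> [s [us -> sc]] cz ij /fintype.subsetP ijs zij; have [n ns] := sc z cz.
have : uniq (map (tfrac z) (rot n s)) by apply: lt_sorted_uniq; rewrite sorted_map.
have ins : i \in rot n s by rewrite mem_rot; have := ijs i; rewrite !inE eqxx; exact.
have jns : j \in rot n s.
  by rewrite mem_rot; have := ijs j; rewrite !inE eqxx orbT; exact.
move=> /(uniqP 0)/(_ (index i (rot n s)) (index j (rot n s))).
rewrite !inE size_map !index_mem !(nth_map i) ?index_mem// !nth_index//.
move=> /(_ ins jns zij) /(congr1 (nth i (rot n s))).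
by rewrite !nth_index.
Qed.

Lemma chamber_add_edge E c i j : toric_chamber E c ->
  (forall z, c z -> tfrac z i <> tfrac z j) ->
  toric_chamber ([set i; j] |: E)%SET c.
Proof.
move=> cE cij.
have sub : (~` @toric_arrangement R V ([set i; j] |: E)%SET `<=`
    ~` @toric_arrangement R V E)%classic.
  move=> z zE /toric_arrangementP[a [b [abE ab]]]; apply: zE.
  by apply/toric_arrangementP; exists a, b; rewrite finset.in_setU abE orbT.
have csub : (c `<=` ~` toric_arrangement ([set i; j] |: E)%SET)%classic.
  move=> z cz /toric_arrangementP[a [b [+ ab]]]; rewrite finset.in_setU => /orP[].
    move=> /set1P abij; have := cij z cz.
    have : i \in [set a; b]%SET by rewrite abij set21.
    have : j \in [set a; b]%SET by rewrite abij set22.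
    by rewrite !inE => /orP[]/eqP-> /orP[]/eqP->; apply; rewrite ?ab.
  by move=> abE; apply: (chamber_off cE cz); apply/toric_arrangementP; exists a, b.
have [x xE cx] := cE.
have cxx : c x by rewrite cx; exact: connected_component_refl.
exists x; first exact: csub.
apply/seteqP; split.
  by apply: connected_component_max => //; exact: (chamber_connected cE).
rewrite [in X in (_ `<=` X)%classic]cx.
apply: connected_component_max; last exact: component_connected.
  by apply: connected_component_refl; exact: csub.
by apply: subset_trans sub; exact: connected_component_sub.
Qed.

Lemma alpha_bar_sub E E' z : E' \subset E -> alpha_bar E' z \subset alpha_bar E z.
Proof.
move=> /fintype.subsetP EE; apply/fintype.subsetP => -[a b]; rewrite !inE /=.
by move=> /andP[/EE -> ->].
Qed.

(* Two points with the same orientation of [E] but on different sides of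
   [x_i = x_j] would be joined, inside the chamber, by a segment crossing it. *)
Lemma chamber_side E c z z' i j : toric_chamber E c -> c z -> c z' ->
  (forall z, c z -> tfrac z i <> tfrac z j) ->
  alpha_bar E z = alpha_bar E z' ->
  tfrac z i < tfrac z j -> tfrac z' i < tfrac z' j.
Proof.
move=> cE cz cz' cij zz' zij.
rewrite lt_neqAle; apply/andP; split; first by apply/eqP; exact: cij.
rewrite leNgt; apply/negP => z'ij.
pose d := tfrac z j - tfrac z i; pose d' := tfrac z' i - tfrac z' j.
have d0 : 0 < d by rewrite subr_gt0.
have d'0 : 0 < d' by rewrite subr_gt0.
(* The zero of the affine function [y i - y j], which runs from [- d] at [z] to [d'] at [z']. *)
pose t := d / (d + d').
have t01 : 0 <= t <= 1 by rewrite /t divr_ge0 ?ler_pdivrMr /=; lra.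
pose y : euclid := fun a => tfrac z a + t * (tfrac z' a - tfrac z a).
have y01 a : 0 <= y a < 1.
  have z0 := tfrac_ge0 z a; have z1 := tfrac_lt1 z a.
  have z'0 := tfrac_ge0 z' a; have z'1 := tfrac_lt1 z' a.
  (* [segment_itv] is strict, so -1 stands in for the bound 0, which may be attained and is proved
     separately. *)
  have /andP[_ ->] : -1 < y a < 1 by apply: segment_itv => //; lra.
  have /andP[t0 t1] := t01; rewrite andbT /y.
  have := mulr_ge0 t0 z'0; have : 0 <= (1 - t) * tfrac z a by apply: mulr_ge0; lra.
  lra.
apply: (cij (pi y)).
  apply: (mono_chamber cE cz y01) => a b abE ab.
  have : (a, b) \in alpha_bar E z' by rewrite -zz' inE /= abE.
  rewrite inE => /andP[_ /= ab']; rewrite /y.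
  have := tfrac_ge0 z a; have := tfrac_lt1 z b.
  have := tfrac_ge0 z' a; have := tfrac_lt1 z' b => ? ? ? ?.
  suff : 0 < (tfrac z b - tfrac z a)
    + t * ((tfrac z' b - tfrac z' a) - (tfrac z b - tfrac z a)) < 2 by lra.
  by apply: segment_itv => //; lra.
have tE : t * (d + d') = d by rewrite /t divfK//; apply: lt0r_neq0; lra.
rewrite !tfrac_pi_id// /y; move: tE; rewrite -/t /d /d'; lra.
Qed.

End ToricChambers.

(** * The dichotomy for a non-edge *)

Theorem theorem7p1 (R : realType) (V : finType) (c : set (torus R V))
    (E : {set {set V}}) (w : {set V * V}) (i j : V) :
  toric_poset c ->
  simple_graph E -> toric_chamber E c ->
  acyclic_orientation E w -> alpha_bar_class E c w ->
  i <> j -> [set i; j]%SET \notin E ->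
  ((exists2 C : {set V}, toric_chain c C & [set i; j]%SET \subset C) /\
   toric_chamber ([set i; j] |: E)%SET c /\
   (exists! w' : {set V * V},
     [/\ acyclic_orientation ([set i; j] |: E)%SET w', w \subset w' &
         alpha_bar_class ([set i; j] |: E)%SET c w']))
  \/
  (~ (exists2 C : {set V}, toric_chain c C & [set i; j]%SET \subset C) /\
   (@toric_hyperplane R V i j `&` c !=set0)%classic).
Proof.
move=> _ _ cE wE cw ij ijE.
have [cij|] := pselect (forall z, c z -> tfrac z i <> tfrac z j); last first.
  move=> /existsNP[z /not_implyP[cz /contrapT zij]]; right; split; last by exists z.
  by move=> [C cC ijC]; exact: chain_no_hyperplane cC cz ij ijC zij.
left; have cE' := chamber_add_edge cE cij.
split; first exact: chamber_chain cE ij cij.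
split=> //.
have cne : exists z, c z.
  by have [x xE ->] := cE; exists x; exact: connected_component_refl.
have real (F : {set {set V}}) w' : toric_chamber F c -> alpha_bar_class F c w' ->
    exists2 z, c z & alpha_bar F z = w'.
  move=> cF cw'; have [z cz] := cne.
  by apply/(toric_equiv_real cF (cw' z cz)); exists z.
have [z cz zw] := real E w cE cw.
exists (alpha_bar ([set i; j] |: E)%SET z); split.
  split.
  - by apply: alpha_bar_acyclic; exact: (chamber_off cE').
  - by rewrite -zw; apply: alpha_bar_sub; exact: finset.subsetUr.
  - by move=> z' cz'; exact: chamber_toric_equiv cE' cz cz'.
move=> w' [_ ww' cw']; have [z' cz' z'w'] := real _ _ cE' cw'.
(* Both are orientations of the same graph, with one arc per edge, so inclusion forces equality. *)
have z'w : alpha_bar E z' = w.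
  apply/setP => -[a b]; have [[wsub wor] _] := wE.
  have sub u v : (u, v) \in w -> (u, v) \in alpha_bar E z'.
    move=> uv; have := fintype.subsetP ww' _ uv; rewrite -z'w' !inE /= => /andP[_ ->].
    by rewrite wsub.
  apply/idP/idP; last exact: sub.
  rewrite inE /= => /andP[abE ab]; rewrite wor//; apply/negP => /sub.
  by rewrite inE /= => /andP[_]; rewrite ltNge ltW.
rewrite -z'w'; apply/setP => -[a b]; rewrite !inE /=.
case: (boolP (_ || _)) => //= abE'.
have abE : [set a; b]%SET \in ([set i; j] |: E)%SET by rewrite !inE.
(* Old edges and the new one are treated alike: [c] avoids all their hyperplanes, so [chamber_side]
   applies to each. *)
have cab u : c u -> tfrac u a <> tfrac u b.
  move=> cu uab; apply: (chamber_off cE' cu).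
  by apply/toric_arrangementP; exists a, b.
have zz' : alpha_bar E z = alpha_bar E z' by rewrite zw z'w.
by apply/idP/idP; [exact: (chamber_side cE cz cz' cab)|exact: (chamber_side cE cz' cz cab)].
Qed.
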